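(* Suppose $\mathbf X=(x,\mathbb X)$ and $\mathbf Y=(y,\mathbb Y)$ are two elements of $WG_p(M)$ such that $x=y$ and $$\int\alpha(d\mathbf X)=\int\alpha(d\mathbf Y)$$ for every finite-dimensional vector space $V$ and every $\alpha\in\Omega^1(M,V)$. Then $\mathbf X=\mathbf Y$ as elements of $WG_p(E)$.
   Context: Fix $T>0$, $p\in[2,3)$ and a control $\omega$, i.e. a continuous superadditive function $\omega:\{(s,t):0\le s\le t\le T\}\to[0,\infty)$ vanishing on the diagonal and positive off it. For a finite-dimensional normed space $W$, $WG_p(W)$ is the set of pairs $\mathbf X=(x,\mathbb X)$ of continuous maps $x:[0,T]\to W$ (the trace) and $\mathbb X:\{0\le s\le t\le T\}\to W\otimes W$ such that, with $x_{s,t}=x_t-x_s$: $\mathbb X_{s,t}=\mathbb X_{s,u}+\mathbb X_{u,t}+x_{s,u}\otimes x_{u,t}$ for $s\le u\le t$; $\sup_{s<t}|x_{s,t}|/\omega(s,t)^{1/p}<\infty$ and $\sup_{s<t}|\mathbb X_{s,t}|/\omega(s,t)^{2/p}<\infty$; and the symmetric part of $\mathbb X_{s,t}$ equals $\frac12 x_{s,t}\otimes x_{s,t}$. For continuous $g,h$ on $\{s\le t\}$, $g_{s,t}\simeq h_{s,t}$ means: there are $\delta>0$ and $C$ with $|g_{s,t}-h_{s,t}|\le C\,\omega(s,t)^{3/p}$ whenever $|t-s|\le\delta$. $E=\mathbb R^N$ and $M\subset E$ is an embedded submanifold of dimension $d$ (locally the zero set of a smooth map $F:U\to\mathbb R^{N-d}$,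 $U\subset E$ open, with surjective differential); $\tau_mM=\mathrm{Nul}(F'(m))\cong T_mM$. $\Omega^1(M,V)$ is the set of smooth $V$-valued one-forms on $M$ ($\alpha_m\in\mathrm{Hom}(T_mM,V)$). Rough integral in $E$: for $U\subset E$ open, $\alpha\in\Omega^1(U,W)$ (a smooth map $U\to\mathrm{Hom}(E,W)$) and $\mathbf X\in WG_p(E)$ with trace in $U$, $\int\alpha(d\mathbf X)$ is the unique $\mathbf Z=(z,\mathbb Z)\in WG_p(W)$ with $z_0=0$, $z_{s,t}\simeq\alpha(x_s)x_{s,t}+\alpha'(x_s)\mathbb X_{s,t}$ and $\mathbb Z_{s,t}\simeq[\alpha(x_s)\otimes\alpha(x_s)]\mathbb X_{s,t}$, where $\alpha'(x)[v\otimes w]=(\partial_v\alpha)(x)w$. $WG_p(M)$ is the set of $\mathbf X\in WG_p(E)$ whose trace lies in $M$ and such that $\int\tilde\alpha(d\mathbf X)\equiv0$ for every finite-dimensional $W$ and every $\tilde\alpha\in\Omega^1(E,W)$ with $\tilde\alpha|_{TM}\equiv0$. For $\mathbf X\in WG_p(M)$ and $\alpha\in\Omega^1(M,V)$, $\int\alpha(d\mathbf X):=\int\tilde\alpha(d\mathbf X)$ where $\tilde\alpha$ is any smooth one-form on an open neighbourhood of $M$ in $E$ with $\tilde\alpha|_{TM}=\alpha$ (the result does not depend on the choice). *)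

(* Defs.v *)
From mathcomp Require Import all_boot all_order all_algebra.
From mathcomp Require Import all_classical all_reals all_analysis.

Set Implicit Arguments.
Unset Strict Implicit.
Unset Printing Implicit Defensive.

Import Order.TTheory GRing.Theory Num.Theory.
Import numFieldNormedType.Exports.

Local Open Scope classical_set_scope.
Local Open Scope ring_scope.

(* Conventions.  A finite-dimensional space is taken to be R^n = 'rV[R]_n (row
   vectors); `| _ | is the library's maximum norm, and as all norms are
   equivalent none of the notions below depends on that choice.
   Hom(R^N, R^n) is 'M[R]_(N, n), the matrix A acting by v |-> v *m A, and
   R^n (x) R^n is 'M[R]_n, the entry (i, j) being the coefficient of
   e_i (x) e_j. *)

Section RoughPaths.
Context {R : realType}.

Definition tens n (v w : 'rV[R]_n) : 'M[R]_n := v^T *m w.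

Definition sympart n (A : 'M[R]_n) : 'M[R]_n := 2^-1 *: (A + A^T).

Definition simplex (T : R) : set (R * R) :=
  [set st | 0 <= st.1 /\ st.1 <= st.2 /\ st.2 <= T].

(* Values are nonnegative because w vanishes on the diagonal and is positive
   off it. *)
Definition control (T : R) (w : R -> R -> R) : Prop :=
  [/\ {within simplex T, continuous (fun st : R * R => w st.1 st.2)},
      forall s u t, 0 <= s -> s <= u -> u <= t -> t <= T ->
        w s u + w u t <= w s t,
      forall t, 0 <= t -> t <= T -> w t t = 0
    & forall s t, 0 <= s -> s < t -> t <= T -> 0 < w s t].

(* A candidate rough path.  Only the values on [0, T] and on the simplex are
   meaningful; see rp_eq. *)
Record rpath (n : nat) := RPath {
  trace : R -> 'rV[R]_n ;
  second : R -> R -> 'M[R]_n }.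

Definition rpath0 (n : nat) : rpath n := RPath (fun=> 0) (fun _ _ => 0).

Definition incr n (X : rpath n) (s t : R) : 'rV[R]_n := trace X t - trace X s.

Definition rp_eq (T : R) n (X Y : rpath n) : Prop :=
  (forall t, 0 <= t -> t <= T -> trace X t = trace Y t) /\
  (forall s t, 0 <= s -> s <= t -> t <= T -> second X s t = second Y s t).

Definition WG (T p : R) (w : R -> R -> R) n (X : rpath n) : Prop :=
  [/\ {within `[0, T]%classic, continuous (trace X)} /\
      {within simplex T,
        continuous (fun st : R * R => second X st.1 st.2)},
      forall s u t, 0 <= s -> s <= u -> u <= t -> t <= T ->
        second X s t =
          second X s u + second X u t + tens (incr X s u) (incr X u t),
      exists C : R, forall s t, 0 <= s -> s < t -> t <= T ->
        `|incr X s t| / w s t `^ (1 / p) <= C,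
      exists C : R, forall s t, 0 <= s -> s < t -> t <= T ->
        `|second X s t| / w s t `^ (2 / p) <= C
    & forall s t, 0 <= s -> s <= t -> t <= T ->
        sympart (second X s t) = 2^-1 *: tens (incr X s t) (incr X s t)].

Definition approx (T p : R) (w : R -> R -> R) (V : normedModType R)
    (g h : R -> R -> V) : Prop :=
  exists delta C : R, 0 < delta /\
    forall s t, 0 <= s -> s <= t -> t <= T -> `|t - s| <= delta ->
      `|g s t - h s t| <= C * w s t `^ (3 / p).

(* C^k on U, for U open.  The values of f outside U play no role. *)
Fixpoint Ck (k : nat) (V W : normedModType R) (U : set V) (f : V -> W) : Prop :=
  if k is k'.+1 then
    (forall x, U x -> differentiable f x) /\
    (forall v, Ck k' U (fun x => 'D_v f x))
  else forall x, U x -> {for x, continuous f}.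

Definition smooth_on (V W : normedModType R) (U : set V) (f : V -> W) : Prop :=
  forall k, Ck k U f.

(* The linear extension to tensors of
   alpha'(x)[v (x) u] = (d_v alpha)(x) u. *)
Definition dform N n (alpha : 'rV[R]_N -> 'M[R]_(N, n)) (x : 'rV[R]_N)
    (A : 'M[R]_N) : 'rV[R]_n :=
  \sum_(i < N) \sum_(j < N)
     A i j *: (delta_mx 0 j *m 'D_(delta_mx 0 i) alpha x).

(* [B (x) B] A *)
Definition tens_hom N n (B : 'M[R]_(N, n)) (A : 'M[R]_N) : 'M[R]_n :=
  B^T *m A *m B.

(* Z is the integral of alpha along X, i.e. it has the properties which
   characterize that integral uniquely (up to rp_eq). *)
Definition is_rough_int (T p : R) (w : R -> R -> R) N n
    (alpha : 'rV[R]_N -> 'M[R]_(N, n)) (X : rpath N) (Z : rpath n) : Prop :=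
  [/\ WG T p w Z,
      trace Z 0 = 0,
      approx T p w (incr Z)
        (fun s t => incr X s t *m alpha (trace X s) +
                    dform alpha (trace X s) (second X s t))
    & approx T p w (second Z)
        (fun s t => tens_hom (alpha (trace X s)) (second X s t))].

Definition local_defining N (d : nat) (M U : set 'rV[R]_N)
    (F : 'rV[R]_N -> 'rV[R]_(N - d)) : Prop :=
  [/\ open U, smooth_on U F,
      M `&` U = [set x | U x /\ F x = 0]
    & forall x, U x -> forall y, exists v, 'd F x v = y].

(* N - d is truncated, hence the condition d <= N. *)
Definition submanifold N (d : nat) (M : set 'rV[R]_N) : Prop :=
  (d <= N)%N /\
  forall m, M m -> exists U F, U m /\ @local_defining N d M U F.

(* Nul(F'(m)); this does not depend on the local defining function F. *)
Definition tau N (d : nat) (M : set 'rV[R]_N) (m : 'rV[R]_N) : set 'rV[R]_N :=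
  [set v | exists U F, [/\ U m, @local_defining N d M U F & 'd F m v = 0]].

(* alpha is the restriction to TM, over the points of A, of the form beta. *)
Definition restricts N n (d : nat) (M A : set 'rV[R]_N)
    (beta : 'rV[R]_N -> 'M[R]_(N, n))
    (alpha : 'rV[R]_N -> 'rV[R]_N -> 'rV[R]_n) : Prop :=
  forall m v, M m -> A m -> tau d M m v -> v *m beta m = alpha m v.

(* Omega^1(M, R^n): alpha m v is meaningful for m in M and v in tau_m M.
   Smoothness on the embedded submanifold M means that alpha is locally the
   restriction of a smooth form on an open subset of the ambient space. *)
Definition oneform N n (d : nat) (M : set 'rV[R]_N)
    (alpha : 'rV[R]_N -> 'rV[R]_N -> 'rV[R]_n) : Prop :=
  (forall m, M m -> forall (a : R) u v, tau d M m u -> tau d M m v ->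
     alpha m (a *: u + v) = a *: alpha m u + alpha m v) /\
  (forall m, M m -> exists (U : set 'rV[R]_N) (beta : 'rV[R]_N -> 'M[R]_(N, n)),
     [/\ open U, U m, smooth_on U beta & restricts d M U beta alpha]).

(* WG_p(M) *)
Definition WGM (T p : R) (w : R -> R -> R) N (d : nat) (M : set 'rV[R]_N)
    (X : rpath N) : Prop :=
  [/\ WG T p w X,
      forall t, 0 <= t -> t <= T -> M (trace X t)
    & forall n (beta : 'rV[R]_N -> 'M[R]_(N, n)),
        smooth_on setT beta -> restricts d M setT beta (fun _ _ => 0) ->
        is_rough_int T p w beta X (rpath0 n)].

(* Z is the integral along X of the one-form alpha on M. *)
Definition is_rough_intM (T p : R) (w : R -> R -> R) N n (d : nat)
    (M : set 'rV[R]_N) (alpha : 'rV[R]_N -> 'rV[R]_N -> 'rV[R]_n)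
    (X : rpath N) (Z : rpath n) : Prop :=
  exists (U : set 'rV[R]_N) (beta : 'rV[R]_N -> 'M[R]_(N, n)),
    [/\ open U, M `<=` U, smooth_on U beta, restricts d M U beta alpha
      & is_rough_int T p w beta X Z].

End RoughPaths.

(* Main.v *)
Require Import Defs.
From HB Require Import structures.
From mathcomp Require Import all_boot all_order all_algebra.
From mathcomp Require Import ring lra.
From mathcomp Require Import all_classical all_reals all_analysis.
Set Implicit Arguments.
Unset Strict Implicit.
Unset Printing Implicit Defensive.
Import Order.TTheory GRing.Theory Num.Theory.
Import numFieldNormedType.Exports.
Local Open Scope classical_set_scope.
Local Open Scope ring_scope.

(** The identity [v |-> v] is a one-form on [M], and its rough integral should
    have second level [second X], so that [X] can be read off from it. The
    integral is however computed with an extension [b] of that form to a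
    neighbourhood of [M], and [b] need be the identity only on the tangent
    spaces. Moreover [X] and [Y] may come with different extensions. What makes
    the argument work is that the second level of a path of [WG_p(M)] is almost
    tangent to [M].

    Almost tangent: if a smooth [f] vanishes on [M], then [f] times the identity
    is a test form in the definition of [WG_p(M)], and the vanishing of its
    integral says that the differential of [f] at [x_s], contracted with the
    first factor of [second X s t], is [O(w(s,t)^(3/p))] ([WGM_differential]).
    Taking for [f] the components of a local equation [F] of [M], multiplied by
    a bump function to make them global ([exists_bump]), gives
    [J^T A = O(w^(3/p))] for the Jacobian matrix [J] of [F] at [x_s] and
    [A = second X s t] ([jac_dominated]). The same holds with [A' = second Y s t],
    as [X] and [Y] have the same trace.

    Independence of the extension: [b - 1] vanishes on the kernel of [J], so
    [b - 1 = J B] with [B] bounded locally. As [A + A^T] is the square of the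
    increment [xi = x_t - x_s], the second level [b^T A b] of the integral is then
    [A + xi^T xi (b - 1)] up to [O(w^(3/p))], and likewise for [Y] with its own
    extension [b']. The integrals along [X] and [Y] being equal, their first
    levels give [xi (b - b') = O(w^(2/p))]; as [xi = O(w^(1/p))], the second levels
    give [A - A' = O(w^(3/p))] ([dominated_sandwich], [second_sub_dominated]).

    Conclusion: [A - A'] is additive in [(s, t)] because the traces agree, and an
    additive function of size [O(w^(3/p))], with [3/p > 1], is zero
    ([additive_dominated_eq0]). All the estimates are local in time; Cousin's lemma
    makes the conclusion global. *)

(** * Calculus of k times continuously differentiable maps *)

Section Calculus.
Context {R : realType}.
Implicit Types V W : normedModType R.

Lemma near_eq_differentiable V W (f g : V -> W) (x : V) :
  (\near x, f x = g x) -> differentiable f x -> differentiable g x.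
Proof.
move=> fg df.
have gE : g \o shift x = cst (g x) + 'd f x +o_ 0 id.
  apply/eqaddoP => e e0.
  have /eqaddoP/(_ e e0) := diff_locally df.
  have : \forall h \near (0 : V), f (h + x) = g (h + x).
    by move: fg; rewrite (near_shift 0 x); apply: filterS => h /=; rewrite subr0.
  apply: filterS2 => h /= fgh.
  by rewrite !fctE /= fgh (nbhs_singleton fg).
have dgf := diff_unique (diff_continuous df) gE.
apply/diff_locallyP; rewrite dgf; split => //.
exact: diff_continuous.
Qed.

Lemma Ck_sub V W k (U U' : set V) (f : V -> W) :
  U `<=` U' -> Ck k U' f -> Ck k U f.
Proof.
move=> UU'; elim: k f => [|k IH] f /=; first by move=> h x /UU'; exact: h.
by move=> [df Df]; split => [x /UU'|v]; [exact: df|exact/IH/Df].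
Qed.

Lemma CkU V W k (U U' : set V) (f : V -> W) :
  Ck k U f -> Ck k U' f -> Ck k (U `|` U') f.
Proof.
elim: k f => [|k IH] f /=; first by move=> h h' x [/h|/h'].
by move=> [df Df] [df' Df']; split => [x [/df|/df']|v] //; exact: IH.
Qed.

Lemma CkS V W k (U : set V) (f : V -> W) : Ck k.+1 U f -> Ck k U f.
Proof.
elim: k f => [|k IH] f; first by case=> df _ x /df /differentiable_continuous.
by move=> [df Df]; split => // v; exact/IH/Df.
Qed.

Lemma Ck_eq V W k (U : set V) (f g : V -> W) : open U ->
  (forall x, U x -> f x = g x) -> Ck k U f -> Ck k U g.
Proof.
move=> oU; have near_eq (h h' : V -> W) x : (forall y, U y -> h y = h' y) ->
    U x -> \near x, h x = h' x.
  by move=> hh' Ux; apply: filterS (open_nbhs_nbhs (conj oU Ux)) => y /hh'.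
elim: k f g => [|k IH] f g fg /=.
  move=> cf x Ux; have := cf _ Ux; rewrite /prop_for /continuous_at -(fg _ Ux).
  move=> fx; apply: cvg_trans fx; apply: near_eq_cvg.
  by have := near_eq _ _ _ fg Ux; apply: filterS => y ->.
move=> [df Df]; split => [x Ux|v].
  exact: near_eq_differentiable (near_eq _ _ _ fg Ux) (df _ Ux).
apply: IH (Df v) => x Ux; apply: near_eq_derive; exact: near_eq.
Qed.

Lemma Ck_cst V W k (U : set V) (c : W) : Ck k U (cst c : V -> W).
Proof.
elim: k c => [|k IH] c /=; first by move=> x _; exact: cvg_cst.
split => [x _|v]; first exact: differentiable_cst.
suff -> : (fun x => 'D_v (cst c : V -> W) x) = cst 0 by [].
by apply/funext => x; rewrite derive_cst.
Qed.

Lemma CkD V W k (U : set V) (f g : V -> W) : open U ->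
  Ck k U f -> Ck k U g -> Ck k U (f + g).
Proof.
move=> oU; elim: k f g => [|k IH] f g /=.
  by move=> cf cg x Ux; apply: cvgD; [exact: cf|exact: cg].
move=> [df Df] [dg Dg]; split => [x Ux|v].
  by apply: differentiableD; [exact: df|exact: dg].
apply: Ck_eq (IH _ _ (Df v) (Dg v)) => // x Ux; rewrite deriveD//.
- exact/diff_derivable/df.
- exact/diff_derivable/dg.
Qed.

Lemma Ck_sum V W k (U : set V) I (r : seq I) (f : I -> V -> W) : open U ->
  (forall i, Ck k U (f i)) -> Ck k U (fun x => \sum_(i <- r) f i x).
Proof.
move=> oU Cf; elim: r => [|i r IH].
  by under eq_fun do rewrite big_nil; exact: Ck_cst.
by under eq_fun do rewrite big_cons; exact: CkD.
Qed.

Lemma CkM V k (U : set V) (f g : V -> R) : open U ->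
  Ck k U f -> Ck k U g -> Ck k U (f * g).
Proof.
move=> oU; elim: k f g => [|k IH] f g.
  by move=> cf cg x Ux; apply: cvgM; [exact: cf|exact: cg].
move=> Cf Cg; have [df Df] := Cf; have [dg Dg] := Cg; split => [x Ux|v].
  by apply: differentiableM; [exact: df|exact: dg].
apply: Ck_eq (CkD oU (IH _ _ (CkS Cf) (Dg v)) (IH _ _ (CkS Cg) (Df v))) => //.
move=> x Ux; rewrite deriveM//; first exact/diff_derivable/df.
exact/diff_derivable/dg.
Qed.

Lemma derive_lin V W W' (L : {linear W -> W'}) (f : V -> W) x v :
  continuous L -> differentiable f x -> 'D_v (L \o f) x = L ('D_v f x).
Proof.
move=> cL df; have dL y : differentiable L y by exact: linear_differentiable.
rewrite !deriveE//; last exact: differentiable_comp.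
by rewrite diff_comp// /= diff_lin.
Qed.

Lemma Ck_lin V W W' k (U : set V) (L : {linear W -> W'}) (f : V -> W) :
  open U -> continuous L -> Ck k U f -> Ck k U (L \o f).
Proof.
move=> oU cL; elim: k f => [|k IH] f /=.
  by move=> cf x Ux; apply: continuous_comp; [exact: cf|exact: cL].
move=> [df Df]; split => [x Ux|v].
  by apply: differentiable_comp; [exact: df|exact: linear_differentiable].
apply: Ck_eq (IH _ (Df v)) => // x Ux /=.
by rewrite derive_lin//; exact: df.
Qed.

(** The outer function [h 0] is given together with all its derivatives [h j], so
    that the induction can treat the functions [h j \o q] simultaneously: each
    directional derivative of [h j \o q] is [h j.+1 \o q] times one of [q]. *)
Lemma Ck_comp V k (U : set V) (h : nat -> R -> R) (q : V -> R) : open U ->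
  (forall j (y : R), is_derive y (1 : R) (h j) (h j.+1 y)) ->
  smooth_on U q -> Ck k U (h 0%N \o q).
Proof.
move=> oU dh Cq; elim: k 0%N => [|k IH] j.
  move=> x Ux; apply: continuous_comp; first exact: (Cq 0%N).
  apply: differentiable_continuous; apply/derivable1_diffP.
  by have [] := dh j (q x).
have dhj y : differentiable (h j) y.
  by apply/derivable1_diffP; have [] := dh j y.
have dq x : U x -> differentiable q x by have [+ _] := Cq 1%N; apply.
split => [x Ux|v]; first by apply: differentiable_comp => //; exact: dq.
have [_ /(_ v) Dq] := Cq k.+1.
apply: Ck_eq (CkM oU (IH j.+1) Dq) => // x Ux.
rewrite deriveE; last by apply: differentiable_comp => //; exact: dq.
rewrite diff_comp//; last exact: dq.
rewrite /= -(deriveE v (dq _ Ux)) diff1E// derive1E; have [_ ->] := dh j (q x).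
by rewrite [RHS]mulrC.
Qed.

End Calculus.

(** * Bump functions *)

Section Bump.
Context {R : realType}.

(** The derivatives of [exp (- 1 / y)] are polynomials in [1 / y] times the
    function itself, so this family, extended by [0] to [y <= 0], is stable
    under differentiation. *)
Definition flat (P : {poly R}) (y : R) : R :=
  if 0 < y then P.[y^-1] * expR (- y^-1) else 0.

Definition dflat (P : {poly R}) : {poly R} := 'X^2 * (P - P^`()).

Lemma exprn_le_expR n (z : R) : 0 <= z -> z ^+ n <= n`!%:R * expR z.
Proof.
case: n => [|n] z0.
  by rewrite expr0 mul1r (le_trans _ (expR_ge1Dx z))// lerDl.
have f0 : 0 < n.+1`!%:R :> R by rewrite ltr0n fact_gt0.
rewrite -ler_pdivrMl// mulrC (le_trans _ (expR_ge1Dxn n z0))// lerDr.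
exact: ler01.
Qed.

Lemma horner_le_expR (P : {poly R}) :
  exists C, forall z, 0 <= z -> `|P.[z]| <= C * expR z.
Proof.
exists (\sum_(i < size P) `|P`_i| * i`!%:R) => z z0.
rewrite horner_coef (le_trans (ler_norm_sum _ _ _))// mulr_suml ler_sum// => i _.
rewrite normrM -mulrA ler_wpM2l// ger0_norm ?exprn_ge0//.
exact: exprn_le_expR.
Qed.

(** The quadratic bound makes the difference quotients at [0] tend to [0]. *)
Lemma flat_le (P : {poly R}) : exists C, forall y, `|flat P y| <= C * y ^+ 2.
Proof.
have [C hC] := horner_le_expR (P * 'X^2).
have C0 : 0 <= C.
  by rewrite -(pmulr_lge0 _ (expR_gt0 0)) (le_trans _ (hC _ (lexx 0))).
exists C => y; rewrite /flat; case: ifPn => y0; last first.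
  by rewrite normr0 mulr_ge0// sqr_ge0.
rewrite normrM (ger0_norm (expR_ge0 _)) expRN.
have := hC y^-1; rewrite hornerM hornerXn invr_ge0 normrM => /(_ (ltW y0)).
rewrite (@ger0_norm _ (y^-1 ^+ 2)); last by rewrite exprn_ge0// invr_ge0 ltW.
rewrite exprVn ler_pdivrMr ?exprn_gt0// => {}hC.
by rewrite ler_pdivrMr ?expR_gt0// mulrAC.
Qed.

Lemma flat_derive0 (P : {poly R}) : is_derive (0 : R) (1 : R) (flat P) (0 : R).
Proof.
have [C hC] := flat_le P.
have f0 : flat P 0 = 0 by rewrite /flat ltxx.
suff cv : h^-1 *: (flat P (h *: 1 + 0) - flat P 0) @[h --> (0:R)^'] --> (0 : R).
  split; first by apply/cvg_ex; exists 0; move: cv; under eq_fun do rewrite addr0.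
  by apply/cvg_lim => //; move: cv; under eq_fun do rewrite addr0.
have C0 : 0 <= C by have := hC 1; rewrite expr1n mulr1; exact: le_trans.
apply/cvgrPdist_le => e e0; near=> h.
have h0 : h != 0 by near: h; exact: nbhs_dnbhs_neq.
rewrite f0 subr0 addr0 sub0r normrN normrZ normfV ler_pdivrMl ?normr_gt0//.
rewrite [h *: 1]mulr1 (le_trans (hC _))//.
rewrite -real_normK ?num_real// expr2 mulrA mulrC ler_wpM2l//.
rewrite (@le_trans _ _ ((C + 1) * `|h|))// ?ler_wpM2r ?lerDl// mulrC.
rewrite -ler_pdivlMr; last by rewrite ltr_wpDl.
near: h; apply: dnbhs0_le; rewrite divr_gt0// ltr_wpDl//.
Unshelve. all: by end_near. Qed.

Lemma flat_derive (P : {poly R}) (y : R) :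
  is_derive y (1 : R) (flat P) (flat (dflat P) y).
Proof.
have [y0|y0|->] := ltgtP y 0; last 1 first.
- by rewrite [flat (dflat P) 0]/flat ltxx; exact: flat_derive0.
- rewrite [flat (dflat P) y]/flat ltNge (ltW y0) /=.
  apply: (@near_eq_is_derive _ _ _ (cst 0)).
    near=> x; suff x0 : x < 0 by rewrite /flat ltNge (ltW x0).
    by near: x; exact: lt_nbhsl.
- rewrite {2}/flat y0 /dflat.
  have yn0 : y != 0 by rewrite gt_eqF.
  have dV : is_derive y (1:R) (fun x : R => x^-1) (- y ^- 2).
    have := is_deriveV yn0 (is_derive_id y (1 : R)).
    by rewrite [_ *: 1]mulr1.
  apply: (@near_eq_is_derive _ _ _
      ((horner P \o (fun x => x^-1)) * (expR \o (-%R \o (fun x => x^-1))))).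
    near=> x; suff x0 : 0 < x by rewrite /flat x0.
    by near: x; exact: lt_nbhsr.
  apply: is_derive_eq.
  rewrite /= hornerM hornerXn hornerD hornerN -!exprVn; set z := y^-1.
  by rewrite /GRing.scale /=; ring.
Unshelve. all: by end_near. Qed.

Let coord_linear m n i j : linear (fun A : 'M[R]_(m, n) => A i j).
Proof. by move=> a A B; rewrite !mxE. Qed.

Definition entry m n i j : {linear 'M[R]_(m, n) -> R} :=
  HB.pack (fun A : 'M[R]_(m, n) => A i j)
    (GRing.isLinear.Build R _ R _ _ (coord_linear i j)).

Lemma smooth_entry m n i j (U : set 'M[R]_(m, n)) :
  open U -> smooth_on U (fun A => A i j).
Proof.
move=> oU k; apply: (Ck_lin (L := entry i j) (f := id) oU).
  exact: coord_continuous.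
case: k => [|k]; first by move=> x _; exact: cvg_id.
split => [x _|v]; first exact: ex_diff.
have -> : (fun x => 'D_v id x) = cst v by apply/funext => x; rewrite derive_id.
exact: Ck_cst.
Qed.

Lemma smooth_sqdist N (m : 'rV[R]_N) (a b : R) :
  smooth_on setT (fun x : 'rV[R]_N => a + b * \sum_i (x 0 i - m 0 i) ^+ 2).
Proof.
move=> k; have oT := @openT 'rV[R]_N.
apply: (CkD (f := cst a)) => //; first exact: Ck_cst.
apply: (CkM (f := cst b)) => //; first exact: Ck_cst.
apply: Ck_sum => // i; rewrite (_ : (fun _ => _) = (fun x : 'rV[R]_N =>
  x 0 i + - m 0 i) * (fun x => x 0 i + - m 0 i)); last exact/funext.
by apply: CkM => //; apply: CkD (smooth_entry _ _ _ _) (Ck_cst _ _ _).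
Qed.

(** The bump [exp (- 1 / (r - |x - m|^2))], extended by [0], with the Euclidean
    distance and a radius small enough for its support to lie in [U]. It is not
    made constant near [m]: positivity at [m] is what the charts require. The
    open set [V], which covers the complement of [U], serves to glue [phi * g]
    to [0] for a function [g] smooth on [U]. *)
Lemma exists_bump N (U : set 'rV[R]_N) m : open U -> U m ->
  exists phi : 'rV[R]_N -> R, exists V : set 'rV[R]_N,
  [/\ smooth_on setT phi, 0 < phi m, open V, forall x, U x \/ V x
    & forall x, V x -> phi x = 0].
Proof.
move=> oU Um.
have /nbhs_ballP[e /= e0 eU] := open_nbhs_nbhs (conj oU Um).
pose q (x : 'rV[R]_N) := \sum_i (x 0 i - m 0 i) ^+ 2.
pose r := e ^+ 2 / 2.
have e20 : 0 < e ^+ 2 by rewrite exprn_gt0.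
have r0 : 0 < r by rewrite divr_gt0.
have := smooth_sqdist m r (-1).
under eq_fun do rewrite mulN1r.
move=> sq.
exists (flat 1 \o (fun x => r - q x)), [set x | r - q x < 0]; split.
- move=> k; exact: (Ck_comp k openT (h := fun j => flat (iter j dflat 1))
                      (fun j y => flat_derive _ y) sq).
- rewrite /= /flat /q big1 => [|i _]; last by rewrite subrr expr0n.
  by rewrite subr0 r0 hornerC mul1r expR_gt0.
- apply: (open_comp (f := fun x => r - q x) (D := [set y | y < 0])) => [x _|].
    exact: (sq 0%N).
  exact: open_lt.
- move=> x; have [xV|qr] := ltP (r - q x) 0; [by right|left].
  apply: eU; rewrite -ball_normE /= distrC /Num.norm /= mx_normrE.
  apply: bigmax_lt => // -[i0 i] _ /=; rewrite (ord1 i0) !mxE.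
  rewrite -(@ltr_pXn2r _ 2)// ?nnegrE ?(ltW e0)// real_normK ?num_real//.
  apply: (@le_lt_trans _ _ r); last first.
    by rewrite /r ltr_pdivrMr// mulr_natr mulr2n ltrDl.
  rewrite subr_ge0 in qr; apply: le_trans qr; rewrite /q (bigD1 i)//= lerDl.
  by apply: sumr_ge0 => j _; exact: sqr_ge0.
- by move=> x /= qr; rewrite /flat ltNge ltW.
Qed.

End Bump.

(** * Norms of matrices and local domination *)

Section Matrices.
Context {R : realType}.

Lemma mx_norm_le m n (A : 'M[R]_(m, n)) c :
  0 <= c -> (forall i j, `|A i j| <= c) -> `|A| <= c.
Proof.
by move=> c0 Ac; rewrite /Num.norm /= mx_normrE; apply: bigmax_le => // -[i j].
Qed.

Lemma entry_le_mx_norm m n (A : 'M[R]_(m, n)) i j : `|A i j| <= `|A|.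
Proof.
rewrite [leRHS]/Num.norm /= mx_normrE.
exact: (le_bigmax _ (fun ij => `|A ij.1 ij.2|) (i, j)).
Qed.

Lemma norm_mulmx m n k (A : 'M[R]_(m, n)) (B : 'M[R]_(n, k)) :
  `|A *m B| <= n%:R * (`|A| * `|B|).
Proof.
apply: mx_norm_le => [|i j]; first by rewrite !mulr_ge0.
rewrite mxE (le_trans (ler_norm_sum _ _ _))//.
rewrite -[n in n%:R]card_ord mulr_natl -sumr_const ler_sum// => l _.
by rewrite normrM ler_pM// entry_le_mx_norm.
Qed.

Lemma norm_trmx m n (A : 'M[R]_(m, n)) : `|A^T| = `|A|.
Proof.
have le k l (B : 'M[R]_(k, l)) : `|B^T| <= `|B|.
  by apply: mx_norm_le => // i j; rewrite mxE entry_le_mx_norm.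
by apply/le_anti; rewrite le /= -{1}[A]trmxK le.
Qed.

(** A left inverse [P0] of [J m0] is nearly a left inverse of [J m] for [m] close
    to [m0]. Multiplying it by the inverse of [P0 *m J m], which is close to [1],
    makes it an exact one, with a bound uniform in [m]. *)
Lemma near_left_inverse N k (J : 'rV[R]_N -> 'M[R]_(N, k)) (m0 : 'rV[R]_N) :
  {for m0, continuous J} -> (forall y, exists v : 'rV_N, v *m J m0 = y) ->
  exists (P : 'rV[R]_N -> 'M[R]_(k, N)) (C : R),
    \forall m \near m0, P m *m J m = 1%:M /\ `|P m| <= C.
Proof.
move=> cJ sJ.
have [v vE] := choice (fun i : 'I_k => sJ (row i 1%:M)).
pose P0 := \matrix_i v i.
have P0J : P0 *m J m0 = 1%:M.
  by apply/row_matrixP => i; rewrite row_mul rowK.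
pose c : R := k%:R * 2.
have c0 : 0 <= c by rewrite mulr_ge0.
exists (fun m => invmx (P0 *m J m) *m P0), (k%:R * ((2 * `|1%:M : 'M[R]_k|) * `|P0|)).
have d0 : 0 < ((c + 1) * (N%:R * `|P0| + 1))^-1.
  by rewrite invr_gt0 mulr_gt0// ltr_wpDl// mulr_ge0.
have /cvgrPdist_le/(_ _ d0) := cJ.
apply: filterS => m mJ.
(* [c = 2 k], where [k] is the loss in the submultiplicativity of the norm. *)
have dG : c * `|1%:M - P0 *m J m| <= 1.
  rewrite -P0J -mulmxBr.
  apply: (@le_trans _ _ (c * (N%:R * (`|P0| * `|J m0 - J m|)))).
    by rewrite ler_wpM2l// norm_mulmx.
  have NP0 : 0 <= N%:R * `|P0| by rewrite mulr_ge0.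
  have := mJ; rewrite -[_^-1]mul1r ler_pdivlMr; last first.
    by rewrite mulr_gt0// ltr_wpDl.
  apply: le_trans; rewrite (mulrA N%:R).
  have : 0 <= `|J m0 - J m| by [].
  move: NP0; set a := N%:R * _ => NP0; set e := `|_| => e0.
  by have := mulr_ge0 e0 c0; have := mulr_ge0 e0 NP0; nra.
(* [P0 *m J m] is within [1/2] of the identity in the operator sense, so that
   multiplication by it at most halves norms. *)
have le2 l (B : 'M[R]_(l, k)) : `|B| <= 2 * `|B *m (P0 *m J m)|.
  have : `|B| <= `|B *m (1%:M - P0 *m J m)| + `|B *m (P0 *m J m)|.
    by rewrite (le_trans _ (ler_normD _ _))// -mulmxDr subrK mulmx1.
  have := norm_mulmx B (1%:M - P0 *m J m).
  have : `|B| * (c * `|1%:M - P0 *m J m|) <= `|B| * 1 by exact: ler_wpM2l.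
  by rewrite /c; nra.
have uG : P0 *m J m \in unitmx.
  rewrite -row_free_unit; apply: inj_row_free => u uG.
  apply/eqP; rewrite -normr_le0 (le_trans (le2 _ _))//.
  by rewrite uG normr0 mulr0.
split; first by rewrite -mulmxA mulVmx.
rewrite (le_trans (norm_mulmx _ _))// ler_wpM2l// ler_wpM2r//.
by rewrite (le_trans (le2 _ _))// mulVmx.
Qed.

End Matrices.

Section Domination.
Context {R : realType} {S : Type} (F : set_system S) {FF : Filter F}.
Implicit Types (h : S -> R) (V : normedModType R).

Definition dominated V h (g : S -> V) : Prop :=
  exists C, \forall z \near F, `|g z| <= C * h z.

Lemma dominatedD V h (f g : S -> V) :
  dominated h f -> dominated h g -> dominated h (fun z => f z + g z).
Proof.
move=> [C hf] [D hg]; exists (C + D); apply: filterS2 hf hg => z hf hg.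
by rewrite mulrDl (le_trans (ler_normD _ _))// lerD.
Qed.

Lemma dominatedN V h (g : S -> V) :
  dominated h g -> dominated h (fun z => - g z).
Proof. by move=> [C hg]; exists C; apply: filterS hg => z; rewrite normrN. Qed.

Lemma dominatedB V h (f g : S -> V) :
  dominated h f -> dominated h g -> dominated h (fun z => f z - g z).
Proof. by move=> hf hg; apply: dominatedD => //; exact: dominatedN. Qed.

Lemma near_dominated V h (f g : S -> V) :
  (\forall z \near F, f z = g z) -> dominated h f -> dominated h g.
Proof. by move=> fg [C hf]; exists C; apply: filterS2 fg hf => z ->. Qed.

Lemma dominated_tr m n h (A : S -> 'M[R]_(m, n)) :
  dominated h A -> dominated h (fun z => (A z)^T).
Proof. by move=> [C hA]; exists C; apply: filterS hA => z; rewrite norm_trmx. Qed.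

Lemma dominated_mulmx m n k h h' (A : S -> 'M[R]_(m, n)) (B : S -> 'M[R]_(n, k)) :
  dominated h A -> dominated h' B ->
  dominated (fun z => h z * h' z) (fun z => A z *m B z).
Proof.
move=> [C hA] [D hB]; exists (n%:R * (C * D)); apply: filterS2 hA hB => z hA hB.
rewrite (le_trans (norm_mulmx _ _))// -mulrA ler_wpM2l// mulrACA.
by rewrite ler_pM.
Qed.

Lemma dominated_mulmxl m n k h (A : S -> 'M[R]_(m, n)) (B : S -> 'M[R]_(n, k)) :
  dominated (fun=> 1) A -> dominated h B -> dominated h (fun z => A z *m B z).
Proof.
move=> hA hB; have := dominated_mulmx hA hB.
by under eq_fun do rewrite mul1r.
Qed.

Lemma dominated_mulmxr m n k h (A : S -> 'M[R]_(m, n)) (B : S -> 'M[R]_(n, k)) :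
  dominated h A -> dominated (fun=> 1) B -> dominated h (fun z => A z *m B z).
Proof.
move=> hA hB; have := dominated_mulmx hA hB.
by under eq_fun do rewrite mulr1.
Qed.

(** Here [b - 1 = J B] and [a + a^T = xi^T xi] give the exact identity
    [b^T a b = a + xi^T xi (b - 1) + B^T (J^T a) b - (J^T a)^T B],
    whose last two terms are dominated as soon as [J^T a] is. Subtracting its two
    instances leaves [A - A'] and the product of [xi^T] with [xi (b - b')]. *)
Lemma dominated_sandwich N k h1 h2 (A A' b b' : S -> 'M[R]_N)
    (xi : S -> 'rV[R]_N) (J : S -> 'M[R]_(N, k)) (B B' : S -> 'M[R]_(k, N)) :
  let h := fun z => h1 z * h2 z in
  (\forall z \near F, A z + (A z)^T = (xi z)^T *m xi z /\
                      A' z + (A' z)^T = (xi z)^T *m xi z) ->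
  (\forall z \near F, b z - 1%:M = J z *m B z /\ b' z - 1%:M = J z *m B' z) ->
  dominated (fun=> 1) b -> dominated (fun=> 1) b' ->
  dominated (fun=> 1) B -> dominated (fun=> 1) B' ->
  dominated h1 xi -> dominated h2 (fun z => xi z *m (b z - b' z)) ->
  dominated h (fun z => (J z)^T *m A z) -> dominated h (fun z => (J z)^T *m A' z) ->
  dominated h (fun z => tens_hom (b z) (A z) - tens_hom (b' z) (A' z)) ->
  dominated h (fun z => A z - A' z).
Proof.
move=> h symA bJ db db' dB dB' dxi dxib dJA dJA' dE.
(* [K a c D] collects the terms of the identity that involve [J^T a]. *)
pose K (a : S -> 'M[R]_N) (c : S -> 'M[R]_N) (D : S -> 'M[R]_(k, N)) z :=
  (D z)^T *m ((J z)^T *m a z) *m c z - ((J z)^T *m a z)^T *m D z.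
have dK a c D : dominated h (fun z => (J z)^T *m a z) -> dominated (fun=> 1) c ->
    dominated (fun=> 1) D -> dominated h (K a c D).
  move=> dJa dc dD; apply: dominatedB.
    by apply: dominated_mulmxr => //; apply: dominated_mulmxl (dominated_tr _) _.
  by apply: dominated_mulmxr => //; exact: dominated_tr.
have main := dominatedB (dominatedD (dominatedB dE (dK _ _ _ dJA db dB))
  (dK _ _ _ dJA' db' dB')) (dominated_mulmx (dominated_tr dxi) dxib).
apply: near_dominated main; apply: filterS2 symA bJ => z [sA sA'] [bB bB'].
have expand (a c : 'M[R]_N) (D : 'M[R]_(k, N)) : a + a^T = (xi z)^T *m xi z ->
    c - 1%:M = J z *m D ->
    tens_hom c a - (D^T *m ((J z)^T *m a) *m c - ((J z)^T *m a)^T *m D) =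
    a + (xi z)^T *m (xi z *m (c - 1%:M)).
  move=> sa cD.
  have -> : D^T *m ((J z)^T *m a) = (c - 1%:M)^T *m a.
    by rewrite mulmxA -trmx_mul -cD.
  have -> : ((J z)^T *m a)^T *m D = a^T *m (c - 1%:M).
    by rewrite trmx_mul trmxK -mulmxA -cD.
  rewrite (mulmxA (xi z)^T) -sa /tens_hom.
  have [e ->] : exists e, c = e + 1%:M by exists (c - 1%:M); rewrite subrK.
  have eT : (e + 1%:M)^T = e^T + 1%:M by rewrite linearD /= trmx1.
  rewrite addrK eT (mulmxDl e^T) mul1mx (mulmxDl (e^T *m a)) opprB.
  rewrite [_ + (a^T *m e - _)]addrC subrKA mulmxDr mulmx1 mulmxDl.
  by rewrite addrA addrC [a^T *m e + _]addrC.
have xiB : xi z *m (b z - b' z) =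
    xi z *m (b z - 1%:M) - xi z *m (b' z - 1%:M).
  by rewrite -mulmxBr opprB addrA subrK.
rewrite xiB (mulmxBr (xi z)^T).
have := expand _ _ _ sA bB; have := expand _ _ _ sA' bB'.
rewrite -/(K A b B z) -/(K A' b' B' z) => /matrixP E' /matrixP E.
apply/matrixP => i j; have := E i j; have := E' i j; rewrite /= !mxE.
lra.
Qed.

End Domination.

(** * Local equations of the submanifold *)

Section Charts.
Context {R : realType}.

(** The components of a local equation become global smooth functions that
    vanish on all of [M] once multiplied by a bump supported in the chart. *)
Lemma local_defining_extension N d (M U : set 'rV[R]_N)
    (F : 'rV[R]_N -> 'rV[R]_(N - d)) m :
  @local_defining R N d M U F -> U m ->
  exists phi : 'rV[R]_N -> R,
    [/\ smooth_on setT phi, 0 < phi m,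
        forall i, smooth_on setT (fun x => phi x * F x 0 i)
      & forall i x, M x -> phi x * F x 0 i = 0].
Proof.
move=> [oU sF MU _] Um.
have [phi [V [sphi phi0 oV UV phiV]]] := exists_bump oU Um.
exists phi; split => // [i k|i x Mx].
  have -> : setT = U `|` V by apply/seteqP; split => x // _; exact: UV.
  apply: CkU; last by apply: Ck_eq (Ck_cst k V 0) => // x /phiV ->; rewrite mul0r.
  apply: (CkM (g := fun x => F x 0 i)) => //; first exact: Ck_sub (sphi k).
  by apply: (Ck_lin (L := entry 0 i)) => //; exact: coord_continuous.
have [Ux|Vx] := UV x; last by rewrite phiV// mul0r.
have : (M `&` U) x by [].
by rewrite MU => -[_ ->]; rewrite mxE mulr0.
Qed.

Definition jac N k (F : 'rV[R]_N -> 'rV[R]_k) (m : 'rV[R]_N) : 'M[R]_(N, k) :=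
  lin1_mx ('d F m).

Lemma mul_jac N k (F : 'rV[R]_N -> 'rV[R]_k) m v : v *m jac F m = 'd F m v.
Proof. exact: mul_rV_lin1. Qed.

Lemma cvg_mx (T : Type) (G : set_system T) {FG : Filter G} m n
    (A : T -> 'M[R]_(m, n)) (B : 'M[R]_(m, n)) :
  (forall i j, A z i j @[z --> G] --> B i j) -> A @ G --> B.
Proof.
move=> AB; apply/cvgrPdist_le => e e0; near=> z.
apply: mx_norm_le => [|i j]; first exact: ltW.
rewrite !mxE; move: i j; near: z; apply: filter_forall => i.
apply: filter_forall => j.
by have /cvgrPdist_le/(_ _ e0) := AB i j.
Unshelve. all: by end_near. Qed.

Lemma jac_continuous N k (F : 'rV[R]_N -> 'rV[R]_k) (U : set 'rV[R]_N) m :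
  open U -> smooth_on U F -> U m -> {for m, continuous (jac F)}.
Proof.
move=> oU sF Um; have [dF DF] := sF 1%N.
apply: (cvg_mx (G := nbhs m)) => i j.
have dE x : U x -> jac F x i j = 'D_(delta_mx 0 i) F x 0 j.
  by move=> Ux; rewrite mxE deriveE//; exact: dF.
rewrite [X in _ --> X](dE _ Um).
have := cvg_comp _ _ (DF (delta_mx 0 i) m Um) (@coord_continuous R 1 k 0 j _).
apply: cvg_trans; apply: near_eq_cvg.
by apply: filterS (open_nbhs_nbhs (conj oU Um)) => x /dE.
Qed.

Lemma dformE N n (b : 'rV[R]_N -> 'M[R]_(N, n)) x A :
  dform b x A = \sum_i (delta_mx 0 i *m A) *m 'D_(delta_mx 0 i) b x.
Proof.
apply: eq_bigr => i _; rewrite -rowE [row i A]row_sum_delta mulmx_suml.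
by apply: eq_bigr => j _; rewrite mxE scalemxAl.
Qed.

(** Multiplying a function [f] that vanishes on [M] by the identity gives a form
    that vanishes at the points of [M], hence annihilates the tangent spaces,
    but whose derivative there contracts the first factor of the second level
    with the differential of [f]. *)
Lemma WGM_differential (T p : R) (w : R -> R -> R) N d (M : set 'rV[R]_N) (X : rpath N)
    (f : 'rV[R]_N -> R) :
  WGM T p w d M X -> smooth_on setT f -> (forall x, M x -> f x = 0) ->
  Defs.approx T p w (fun s t => (\row_i 'D_(delta_mx 0 i) f (trace X s)) *m second X s t)
    (fun _ _ => 0).
Proof.
move=> [_ MX intX] sf f0.
have lin : linear (fun a : R => a *: (1%:M : 'M[R]_N)).
  by move=> a u v; rewrite scalerDl scalerA.
pose L : {linear R -> 'M[R]_N} := HB.pack (fun a : R => a *: (1%:M : 'M[R]_N))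
  (GRing.isLinear.Build R R _ _ _ lin).
have cL : continuous L by exact: scalel_continuous.
have sLf : smooth_on setT (L \o f) by move=> k; apply: Ck_lin => //; exact: openT.
have rLf : restricts d M setT (L \o f) (fun _ _ => 0).
  by move=> m v Mm _ _; rewrite /= f0// scale0r mulmx0.
have [_ _ [delta [C [d0 hC]]] _] := intX _ _ sLf rLf.
exists delta, C; split => // s t s0 st tT std.
have := hC s t s0 st tT std.
have -> : incr (rpath0 N) s t = 0 :> 'rV[R]_N by rewrite /incr subrr.
have Lf0 : (L \o f) (trace X s) = 0.
  by rewrite /= f0 ?scale0r//; apply: MX => //; exact: le_trans tT.
rewrite subr0 sub0r normrN Lf0 mulmx0 add0r; congr (`|_| <= _).
rewrite dformE (row_sum_delta (\row_i _)) mulmx_suml.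
apply: eq_bigr => i _; rewrite derive_lin//; last by have [+ _] := sf 1%N; apply.
by rewrite /= mxE -scalemxAr mulmx1 scalemxAl.
Qed.

End Charts.

(** * Estimates near a time *)

Section Corner.
Context {R : realType} (T p : R) (w : R -> R -> R) (s0 : R).
Hypotheses (hp : 2 <= p < 3) (hw : control T w) (s00 : 0 <= s0) (s0T : s0 <= T).

(** Pairs of times [s <= t] close to [s0]: all the estimates are local there. *)
Definition corner : set_system (R * R) := within (simplex T) (nbhs (s0, s0)).

(** [w(s,t)^(k/p)], the size of a term of degree [k] in the increments. *)
Definition scale (k : R) (z : R * R) : R := w z.1 z.2 `^ (k / p).

Let p0 : 0 < p. Proof. by case/andP: hp => p2 _; rewrite (lt_le_trans _ p2). Qed.

Lemma near_corner : \forall z \near corner, simplex T z.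
Proof. exact: withinT. Qed.

Lemma control_ge0 z : simplex T z -> 0 <= w z.1 z.2.
Proof.
case: hw => _ _ w0 wpos [z0 [z12 zT]].
have [z12'|z21|<-] := ltgtP z.1 z.2; first exact/ltW/wpos.
  by move: z12; rewrite leNgt z21.
by rewrite w0// (le_trans z12).
Qed.

Lemma control_corner : w z.1 z.2 @[z --> corner] --> 0.
Proof.
case: hw => /subspace_continuousP wc _ w0 _.
rewrite -(w0 _ s00 s0T); exact: (wc (s0, s0)).
Qed.

Lemma cvg_corner_fst : fst @ corner --> within `[0, T]%classic (nbhs s0).
Proof.
move=> A hA.
have fstE : fst @ nbhs (s0, s0) --> nbhs s0 by exact: cvg_fst.
have {fstE}hA : \forall z \near (s0, s0), `[0, T]%classic z.1 -> A z.1.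
  exact: fstE hA.
apply: (filterS (F := nbhs (s0, s0))) hA => z Az [z0 [z12 zT]].
by apply: Az; rewrite /= in_itv /= z0 (le_trans z12).
Qed.

Lemma trace_corner N (X : rpath N) : WG T p w X ->
  trace X z.1 @[z --> corner] --> trace X s0.
Proof.
move=> [[/subspace_continuousP cX _] _ _ _ _].
have x0 : `[0, T]%classic s0 by rewrite /= in_itv /= s00.
exact: (cvg_comp _ _ cvg_corner_fst (cX _ x0)).
Qed.

Lemma corner_dist e : 0 < e -> \forall z \near corner, `|z.2 - z.1| <= e.
Proof.
move=> e0; apply: cvg_within.
have c : (fun z : R * R => z.2 - z.1) @ nbhs (s0, s0) --> s0 - s0.
  by apply: cvgB; [exact: cvg_snd|exact: cvg_fst].
move/cvgrPdist_le/(_ _ e0) : c; apply: filterS => z.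
by rewrite subrr sub0r normrN.
Qed.

Lemma approx_dominated (V : normedModType R) (g h : R -> R -> V) :
  Defs.approx T p w g h ->
  dominated corner (scale 3) (fun z => g z.1 z.2 - h z.1 z.2).
Proof.
move=> [delta [C [d0 gh]]]; exists C.
by apply: filterS2 near_corner (corner_dist d0) => z [z0 [z12 zT]]; exact: gh.
Qed.

Lemma cvg_dominated (V : normedModType R) (g : R * R -> V) (l : V) :
  g @ corner --> l -> dominated corner (fun=> 1) g.
Proof.
move=> /cvgrPdist_le/(_ _ (@ltr01 R)) gl; exists (`|l| + 1).
apply: filterS gl => z; rewrite mulr1 distrC => gl.
by rewrite -[g z](subrK l) addrC (le_trans (ler_normD _ _))// lerD2l.
Qed.

Lemma scaleD j k z : 0 < j -> 0 < k -> scale (j + k) z = scale j z * scale k z.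
Proof.
move=> j0 k0; rewrite /scale mulrDl powRD//.
by apply/implyP; rewrite gt_eqF// addr_gt0// divr_gt0.
Qed.

(** Near the diagonal the control is at most [1], hence higher degrees are
    smaller. *)
Lemma dominated_scale (V : normedModType R) j k (g : R * R -> V) : j <= k ->
  0 < j -> dominated corner (scale k) g -> dominated corner (scale j) g.
Proof.
move=> jk j0 [C hg]; exists `|C|.
have := control_corner => /cvgrPdist_le/(_ _ (@ltr01 R)).
apply: filterS3 near_corner hg => z sz hg.
rewrite sub0r normrN ger0_norm; last exact: control_ge0.
move=> w1; rewrite (le_trans hg)//.
apply: (@le_trans _ _ (`|C| * scale k z)).
  by rewrite ler_wpM2r ?powR_ge0// ler_norm.
rewrite ler_wpM2l// /scale.
have := control_ge0 sz; rewrite le_eqVlt => /orP[/eqP<-|wz].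
  by rewrite !powR0// gt_eqF// divr_gt0// (lt_le_trans j0).
by apply: ger_powR; rewrite ?wz// ler_pM2r ?invr_gt0.
Qed.

Lemma incr_dominated N (X : rpath N) : WG T p w X ->
  dominated corner (scale 1) (fun z => incr X z.1 z.2).
Proof.
move=> [_ _ [C hC] _ _]; exists C; apply: filterS near_corner => z [z0 [z12 zT]].
move: z12; rewrite le_eqVlt => /orP[/eqP z12|z12].
  have wz : w z.1 z.1 = 0 by case: hw => _ _ w0 _; rewrite w0// z12.
  rewrite /incr -z12 subrr normr0 /scale -z12 wz.
  by rewrite powR0 ?mulr0// gt_eqF// divr_gt0.
rewrite -ler_pdivrMr; first exact: hC.
by case: hw => _ _ _ wpos; rewrite powR_gt0// wpos.
Qed.

Lemma second_dominated N (X : rpath N) : WG T p w X ->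
  dominated corner (scale 2) (fun z => second X z.1 z.2).
Proof.
move=> [_ chen _ [C hC] _]; exists C; apply: filterS near_corner => z [z0 [z12 zT]].
move: z12; rewrite le_eqVlt => /orP[/eqP z12|z12].
  have zT' : z.1 <= T by rewrite z12.
  (* Chen's relation at [s = u = t] forces the second level to vanish there. *)
  have := chen _ _ _ z0 (lexx z.1) (lexx _) zT'.
  rewrite /tens /incr subrr mulmx0 addr0 => /esym/eqP.
  rewrite -subr_eq0 addrK => /eqP sz.
  have wz : w z.1 z.1 = 0 by case: hw => _ _ w0 _; rewrite w0.
  rewrite /scale -z12 sz normr0 wz.
  by rewrite powR0 ?mulr0// gt_eqF// divr_gt0.
rewrite -ler_pdivrMr; first exact: hC.
by case: hw => _ _ _ wpos; rewrite powR_gt0// wpos.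
Qed.

Lemma dform_dominated N n (b : 'rV[R]_N -> 'M[R]_(N, n)) (U : set 'rV[R]_N)
    (X Y : rpath N) :
  open U -> smooth_on U b -> U (trace Y s0) -> WG T p w X -> WG T p w Y ->
  dominated corner (scale 2)
    (fun z => dform b (trace Y z.1) (second X z.1 z.2)).
Proof.
move=> oU sb Us wgX wgY; under eq_fun do rewrite dformE.
elim: (index_enum _) => [|i r IH].
  exists 0; apply: filterS near_corner => z _.
  by rewrite big_nil normr0 mul0r.
under eq_fun do rewrite big_cons; apply: dominatedD IH.
apply: dominated_mulmxr; first apply: dominated_mulmxl (second_dominated wgX).
  by exists `|delta_mx 0 i : 'rV[R]_N|; apply: filterS near_corner => z _; rewrite mulr1.
have [_ Db] := sb 1%N.
exact: cvg_dominated (cvg_comp _ _ (trace_corner wgY) (Db _ _ Us)).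
Qed.

End Corner.

(** * Comparison of the second levels *)

Section Local.
Context {R : realType} (T p : R) (w : R -> R -> R) (N d : nat)
  (M : set 'rV[R]_N).
Hypotheses (hp : 2 <= p < 3) (hw : control T w) (hM : submanifold d M).

(** An extension of the identity one-form of [M] to the open set [U]. *)
Let id_extension (b : 'rV[R]_N -> 'M[R]_N) (U : set 'rV[R]_N) :=
  [/\ open U, M `<=` U, smooth_on U b
    & restricts d M U b (fun _ v => v)].

(** At the points of [M] where [F = 0], the derivative of [phi * F] is [phi] times
    that of [F], and [phi] is bounded below near [trace X s0]. *)
Lemma jac_dominated (X : rpath N) (U : set 'rV[R]_N)
    (F : 'rV[R]_N -> 'rV[R]_(N - d)) s0 :
  0 <= s0 -> s0 <= T -> WGM T p w d M X ->
  @local_defining R N d M U F -> U (trace X s0) ->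
  dominated (corner T s0) (scale p w 3)
    (fun z => (jac F (trace X z.1))^T *m second X z.1 z.2).
Proof.
move=> s00 s0T hX hF Us; have [wgX MX _] := hX; have [oU sF _ _] := hF.
have [phi [sphi phi0 sf f0]] := local_defining_extension hF Us.
pose f i x := phi x * F x 0 i.
have cphi : phi (trace X z.1) @[z --> corner T s0] --> phi (trace X s0).
  exact: (cvg_comp _ _ (trace_corner s00 s0T wgX) (sphi 0%N _ I)).
have row_dom i : dominated (corner T s0) (scale p w 3)
    (fun z => row i ((jac F (trace X z.1))^T *m second X z.1 z.2)).
  have [C hC] := approx_dominated s0
    (WGM_differential hX (sf i) (f0 i)).
  exists (C * (phi (trace X s0) / 2)^-1).
  have Unear : \forall z \near corner T s0, U (trace X z.1).
    exact: (trace_corner s00 s0T wgX (open_nbhs_nbhs (conj oU Us))).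
  have phi2 : 0 < phi (trace X s0) / 2 by rewrite divr_gt0.
  have phi_near : \forall z \near corner T s0,
      phi (trace X s0) / 2 <= phi (trace X z.1).
    have /cvgrPdist_le/(_ _ phi2) := cphi; apply: filterS => z.
    by rewrite ler_distlC => /andP[+ _]; lra.
  near=> z.
  have Uz : U (trace X z.1) by near: z.
  have Mz : M (trace X z.1).
    have [z0 [z12 zT]] : simplex T z by near: z; exact: near_corner.
    by apply: MX => //; exact: le_trans zT.
  have Fz : F (trace X z.1) = 0.
    case: hF => _ _ MU _; have : (M `&` U) (trace X z.1) by [].
    by rewrite MU => -[].
  have grad : \row_j 'D_(delta_mx 0 j) (f i) (trace X z.1) =
      phi (trace X z.1) *: row i (jac F (trace X z.1))^T.
    apply/rowP => j; rewrite !mxE.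
    have dF : differentiable F (trace X z.1) by have [+ _] := sF 1%N; apply.
    have dphi : differentiable phi (trace X z.1) by have [+ _] := sphi 1%N; apply.
    have dFi : differentiable (entry 0 i \o F) (trace X z.1).
      apply: differentiable_comp => //; exact: differentiable_coord.
    rewrite (deriveM (f := phi) (g := entry 0 i \o F)) //; last 2 first.
    - exact: diff_derivable.
    - exact: diff_derivable.
    rewrite derive_lin//; last exact: coord_continuous.
    by rewrite /= Fz mxE scale0r addr0 deriveE.
  have : `|phi (trace X z.1) *: row i ((jac F (trace X z.1))^T *m second X z.1 z.2)|
      <= C * scale p w 3 z.
    have : `|(\row_j 'D_(delta_mx 0 j) (f i) (trace X z.1)) *m second X z.1 z.2 - 0|
      <= C * scale p w 3 z by near: z.
    by rewrite subr0 grad -scalemxAl row_mul.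
  have phiz : phi (trace X s0) / 2 <= phi (trace X z.1) by near: z.
  rewrite normrZ ger0_norm; last by rewrite (le_trans (ltW phi2)).
  rewrite mulrAC ler_pdivlMr// [leLHS]mulrC; apply: le_trans.
  by rewrite ler_wpM2l.
have [C hC] := choice (fun i => row_dom i).
exists (\sum_i `|C i|); near=> z.
have sz : 0 <= scale p w 3 z by exact: powR_ge0.
apply: mx_norm_le => [|i j]; first by rewrite mulr_ge0// sumr_ge0.
apply: (@le_trans _ _ (C i * scale p w 3 z)).
  have : `|row i ((jac F (trace X z.1))^T *m second X z.1 z.2)| <= C i * scale p w 3 z.
    by move: i {j}; near: z; apply: filter_forall.
  by apply: le_trans; rewrite (le_trans _ (entry_le_mx_norm _ 0 j))// [in leRHS]mxE.
rewrite ler_wpM2r// (bigD1 i)//= (le_trans (ler_norm _))// lerDl.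
by rewrite sumr_ge0.
Unshelve. all: by end_near. Qed.


(** The tangent vectors at [m] form the kernel of the Jacobian matrix [J], so a
    form that restricts to the identity on them differs from [1] by a matrix
    that factors through [J]. *)
Lemma restricts_id_factor (b : 'rV[R]_N -> 'M[R]_N) (U V : set 'rV[R]_N)
    (F : 'rV[R]_N -> 'rV[R]_(N - d)) m (P : 'M[R]_(N - d, N)) :
  @local_defining R N d M U F -> U m -> M m -> V m ->
  restricts d M V b (fun _ v => v) -> P *m jac F m = 1%:M ->
  b m - 1%:M = jac F m *m (P *m (b m - 1%:M)).
Proof.
move=> hF Um Mm Vm rb PJ; apply/eqP; rewrite -subr_eq0; apply/eqP.
rewrite mulmxA -{1}[b m - 1%:M]mul1mx -mulmxBl.
apply/row_matrixP => i; rewrite row_mul row0.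
set v := row i _; suff vt : tau d M m v by rewrite mulmxBr mulmx1 rb// subrr.
exists U, F; split => //; rewrite -mul_jac -row_mul mulmxBl mul1mx -mulmxA PJ.
by rewrite mulmx1 subrr row0.
Qed.

(** The common integral [Z] is compared at both levels: the first bounds
    [incr X *m (bX - bY)] by degree [2], since [dform] is of degree [2]; the second
    bounds the difference of the two transformed second levels by degree [3]. *)
Lemma second_sub_dominated (X Y : rpath N) (bX bY : 'rV[R]_N -> 'M[R]_N)
    (Z : rpath N) (UX UY : set 'rV[R]_N) s0 :
  WGM T p w d M X -> WGM T p w d M Y ->
  (forall t, 0 <= t -> t <= T -> trace X t = trace Y t) ->
  id_extension bX UX -> id_extension bY UY ->
  is_rough_int T p w bX X Z -> is_rough_int T p w bY Y Z ->
  0 <= s0 -> s0 <= T ->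
  dominated (corner T s0) (scale p w 3)
    (fun z => second X z.1 z.2 - second Y z.1 z.2).
Proof.
move=> hX hY hxy [oUX MUX sbX rbX] [oUY MUY sbY rbY] [_ _ ZX1 ZX2] [_ _ ZY1 ZY2].
move=> s00 s0T; have [wgX MX _] := hX; have [wgY MY _] := hY.
have Ms : M (trace X s0) by exact: MX.
have [_ /(_ _ Ms) [U [F [Us hF]]]] := hM; have [oU sF _ surF] := hF.
have cX := trace_corner s00 s0T wgX.
have [|P [C PJ]] := near_left_inverse (jac_continuous oU sF Us).
  by move=> y; have [v vy] := surF _ Us y; exists v; rewrite mul_jac.
have {}PJ : \forall z \near corner T s0,
    P (trace X z.1) *m jac F (trace X z.1) = 1%:M /\ `|P (trace X z.1)| <= C.
  exact: cX _ PJ.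
have Unear : \forall z \near corner T s0, U (trace X z.1).
  exact: cX _ (open_nbhs_nbhs (conj oU Us)).
have Mnear : \forall z \near corner T s0,
    [/\ M (trace X z.1), trace Y z.1 = trace X z.1 & trace Y z.2 = trace X z.2].
  apply: filterS (near_corner T s0) => z [z0 [z12 zT]].
  have zT' := le_trans z12 zT; have z0' := le_trans z0 z12.
  by split; [exact: MX|rewrite hxy|rewrite hxy].
have dP : dominated (corner T s0) (fun=> 1) (fun z => P (trace X z.1)).
  by exists C; apply: filterS PJ => z [_]; rewrite mulr1.
have db b V : smooth_on V b -> V (trace X s0) ->
    dominated (corner T s0) (fun=> 1) (fun z => b (trace X z.1) : 'M[R]_N).
  move=> sb Vs; exact: cvg_dominated (cvg_comp _ _ cX (sb 0%N _ Vs)).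
have dB b : dominated (corner T s0) (fun=> 1) (fun z => b (trace X z.1) : 'M[R]_N) ->
    dominated (corner T s0) (fun=> 1)
      (fun z => P (trace X z.1) *m (b (trace X z.1) - 1%:M)).
  move=> dbz; apply: dominated_mulmxl => //; apply: dominatedB => //.
  exists `|1%:M : 'M[R]_N|; apply: filterS (near_corner T s0) => z _.
  by rewrite mulr1.
have dbX := db _ _ sbX (MUX _ Ms); have dbY := db _ _ sbY (MUY _ Ms).
have UYs : UY (trace Y s0) by rewrite -hxy//; exact: MUY.
have le23 : 2 <= 3 :> R by lra.
have dX := dform_dominated hp hw s00 s0T oUX sbX (MUX _ Ms) wgX wgX.
have dY := dform_dominated hp hw s00 s0T oUY sbY UYs wgY wgY.
have dZX := dominated_scale hp hw s00 s0T le23 (ltr0n _ 2) (approx_dominated s0 ZX1).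
have dZY := dominated_scale hp hw s00 s0T le23 (ltr0n _ 2) (approx_dominated s0 ZY1).
have dxib : dominated (corner T s0) (scale p w 2) (fun z =>
    incr X z.1 z.2 *m (bX (trace X z.1) - bY (trace X z.1))).
  apply: near_dominated (dominatedD (dominatedB dZY dZX) (dominatedB dY dX)).
  apply: filterS Mnear => z [_ Y1 Y2].
  have -> : incr Y z.1 z.2 = incr X z.1 z.2 by rewrite /incr Y1 Y2.
  rewrite Y1 mulmxBr.
  move: (incr Z _ _) (dform bX _ _) (dform bY _ _) (_ *m bX _) (_ *m bY _).
  by move=> c d1 d2 e1 e2; apply/rowP => j; rewrite !mxE; lra.
have dE : dominated (corner T s0) (scale p w 3) (fun z =>
    tens_hom (bX (trace X z.1)) (second X z.1 z.2) -
    tens_hom (bY (trace X z.1)) (second Y z.1 z.2)).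
  apply: near_dominated
    (dominatedB (approx_dominated s0 ZY2) (approx_dominated s0 ZX2)).
  apply: filterS Mnear => z [_ Y1 _]; rewrite Y1.
  by rewrite opprB addrC addrA subrK.
have dJX := jac_dominated s00 s0T hX hF Us.
have dJY : dominated (corner T s0) (scale p w 3)
    (fun z => (jac F (trace X z.1))^T *m second Y z.1 z.2).
  have Us' : U (trace Y s0) by rewrite -hxy.
  apply: near_dominated (jac_dominated s00 s0T hY hF Us').
  by apply: filterS Mnear => z [_ -> _].
have s3 : scale p w 3 = (fun z => scale p w 1 z * scale p w 2 z).
  by apply/funext => z; rewrite -(scaleD _ hp)//; congr (scale _ _ _ z); lra.
rewrite s3 in dE dJX dJY *.
apply: (@dominated_sandwich _ _ _ _ _ _ (scale p w 1) (scale p w 2) _ _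
  (fun z => bX (trace X z.1)) (fun z => bY (trace X z.1))
  (fun z => incr X z.1 z.2) (fun z => jac F (trace X z.1))
  (fun z => P (trace X z.1) *m (bX (trace X z.1) - 1%:M))
  (fun z => P (trace X z.1) *m (bY (trace X z.1) - 1%:M))
  _ _ dbX dbY (dB _ dbX) (dB _ dbY)
  (incr_dominated s0 hp hw wgX) dxib dJX dJY dE).
- have symE (W : rpath N) : WG T p w W -> forall z, simplex T z ->
      second W z.1 z.2 + (second W z.1 z.2)^T =
      (incr W z.1 z.2)^T *m incr W z.1 z.2.
    move=> [_ _ _ _ sW] z [z0 [z12 zT]]; have := sW _ _ z0 z12 zT.
    rewrite /sympart /tens => /(congr1 ( *:%R 2)).
    by rewrite !scalerA divff ?scale1r// pnatr_eq0.
  apply: filterS2 (near_corner T s0) Mnear => z sz [_ Y1 Y2].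
  rewrite !symE//; split => //.
  by rewrite /incr Y1 Y2.
- apply: filterS3 Mnear Unear PJ => z [Mz _ _] Uz [PJz _].
  split; first exact: restricts_id_factor hF Uz Mz (MUX _ Mz) rbX PJz.
  exact: restricts_id_factor hF Uz Mz (MUY _ Mz) rbY PJz.
Qed.

End Local.

(** * Additive functions of intervals *)

Section Additive.
Context {R : realType}.

(** Cousin's lemma: the supremum of the endpoints [t] for which [P a t] holds
    belongs to them and cannot be less than [b]. *)
Lemma cousin (P : R -> R -> Prop) (a b : R) : a <= b ->
  (forall x y z, a <= x -> x <= y -> y <= z -> z <= b ->
     P x y -> P y z -> P x z) ->
  (forall c, a <= c -> c <= b -> exists2 e, 0 < e &
     forall x y, a <= x -> x <= y -> y <= b -> `|x - c| < e -> `|y - c| < e ->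
       P x y) ->
  P a b.
Proof.
move=> ab Ptrans Ploc.
pose S := [set t | [/\ a <= t, t <= b & P a t]].
have Sa : S a.
  split => //; have [e e0 Pe] := Ploc a (lexx _) ab.
  by apply: Pe => //; rewrite subrr normr0.
have Sb : ubound S b by move=> t [].
have hS : has_sup S by split; [exists a|exists b].
pose c := sup S.
have ac : a <= c by apply: ub_le_sup => //; exists b.
have cb : c <= b by apply: ge_sup => //; exists a.
have [e e0 Pe] := Ploc c ac cb.
have [t [ta tb Pat] ct] := sup_adherent e0 hS.
have tc : t <= c by apply: ub_le_sup => //; exists b.
pose t' := Num.min b (c + e / 2).
have e2 : 0 < e / 2 by rewrite divr_gt0.
have ct' : c <= t' by rewrite le_min cb lerDl ltW.
have t'c : t' <= c + e / 2 by rewrite ge_min lexx orbT.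
have t'b : t' <= b by rewrite ge_min lexx.
have tt' : t <= t' by exact: le_trans ct'.
have Pat' : P a t'.
  apply: (Ptrans a t t') => //; apply: Pe => //.
    by rewrite distrC ger0_norm ?subr_ge0//; move: ct; rewrite -/c; lra.
  by rewrite ger0_norm ?subr_ge0//; lra.
suff <- : t' = b by [].
have : t' <= c by apply: ub_le_sup; [exists b|split=> //; exact: le_trans tt'].
by rewrite /t' ge_min => /orP[bc|]; [apply/min_idPl|]; lra.
Qed.

(** An additive function of intervals dominated by a power [3 / p > 1] of the
    control vanishes: along fine subdivisions it is at most a small multiple of
    the superadditive control. *)
Lemma additive_dominated_eq0 (T p : R) (w : R -> R -> R) (V : normedModType R)
    (D : R -> R -> V) :
  2 <= p < 3 -> control T w ->
  (forall s u t, 0 <= s -> s <= u -> u <= t -> t <= T -> D s t = D s u + D u t) ->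
  (forall s0, 0 <= s0 -> s0 <= T ->
     dominated (corner T s0) (scale p w 3) (fun z => D z.1 z.2)) ->
  forall s t, 0 <= s -> s <= t -> t <= T -> D s t = 0.
Proof.
move=> hp hw Dadd Dloc s t s_ge0 st tT.
have [p2 p3] := andP hp; have p0 : 0 < p by rewrite (lt_le_trans _ p2).
pose r := 3 / p - 1.
have r0 : 0 < r by rewrite subr_gt0 ltr_pdivlMr// mul1r.
suff small e : 0 < e -> `|D s t| <= e * w s t.
  apply/eqP; rewrite -normr_le0; apply/ler_addgt0Pr => e e0; rewrite add0r.
  have w0 : 0 <= w s t by apply: (control_ge0 (z := (s, t)) hw).
  have w1 : 0 < w s t + 1 by rewrite ltr_wpDl.
  rewrite (le_trans (small _ (divr_gt0 e0 w1)))// mulrAC ler_pdivrMr//.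
  by rewrite ler_wpM2l ?ltW// ltrDl.
move=> e0; apply: (cousin (P := fun x y => `|D x y| <= e * w x y)) => //.
  move=> x y z sx xy yz zt Dxy Dyz.
  have x0 := le_trans s_ge0 sx; have zT := le_trans zt tT.
  rewrite (Dadd _ y)// (le_trans (ler_normD _ _))//.
  rewrite (le_trans (lerD Dxy Dyz))// -mulrDr ler_wpM2l ?(ltW e0)//.
  by case: hw => _ supw _ _; exact: supw.
move=> c sc ct; have c0 := le_trans s_ge0 sc; have cT := le_trans ct tT.
have [C hC] := Dloc c c0 cT.
have C1 : 0 < `|C| + 1 by rewrite ltr_wpDl.
(* Below [del], the excess [w^r] over the first power of the control absorbs
   the constant [C]. *)
pose del := (e / (`|C| + 1)) `^ r^-1.
have del0 : 0 < del by rewrite powR_gt0// divr_gt0.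
have /cvgrPdist_le/(_ _ del0) wdel := control_corner hw c0 cT.
have : \forall z \near corner T c, `|D z.1 z.2| <= e * w z.1 z.2.
  apply: filterS3 (near_corner T c) wdel hC => z sz.
  have w0 := control_ge0 hw sz.
  rewrite sub0r normrN ger0_norm// => wd /le_trans; apply.
  have -> : scale p w 3 z = w z.1 z.2 `^ r * w z.1 z.2.
    rewrite /scale (_ : 3 / p = r + 1); last by rewrite subrK.
    rewrite powRD ?powRr1//; apply/implyP.
    by rewrite gt_eqF// addr_gt0.
  rewrite mulrA ler_wpM2r//.
  have wr : w z.1 z.2 `^ r <= e / (`|C| + 1).
    have -> : e / (`|C| + 1) = del `^ r.
      by rewrite -powRrM mulVf ?gt_eqF// powRr1// ltW// divr_gt0.
    by apply: ge0_ler_powR; rewrite ?nnegrE ?powR_ge0// ltW.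
  rewrite (@le_trans _ _ ((`|C| + 1) * w z.1 z.2 `^ r))//.
    by rewrite ler_wpM2r ?powR_ge0// (le_trans (ler_norm _))// lerDl.
  by rewrite mulrC -ler_pdivlMr.
rewrite /corner => /nbhs_ballP[eta /= eta0 hball].
exists eta => // x y sx xy yt xc yc.
apply: (hball (x, y)); last first.
  by split; [exact: le_trans sx|split => //; exact: le_trans tT].
by split; rewrite /ball /= distrC.
Qed.

End Additive.

(** * The path is determined by its integrals *)

Theorem corollary3p25 (R : realType) (T p : R) (w : R -> R -> R)
  (N d : nat) (M : set 'rV[R]_N) (X Y : rpath (R := R) N)
  (hT : 0 < T) (hp : 2 <= p < 3) (hw : control T w)
  (hM : submanifold d M)
  (hX : WGM T p w d M X) (hY : WGM T p w d M Y)
  (hxy : forall t, 0 <= t -> t <= T -> trace X t = trace Y t)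
  (hint : forall (n : nat) (alpha : 'rV[R]_N -> 'rV[R]_N -> 'rV[R]_n),
     oneform d M alpha ->
     exists Z : rpath n,
       is_rough_intM T p w d M alpha X Z /\ is_rough_intM T p w d M alpha Y Z) :
  rp_eq T X Y.
Proof.
have [|Z [[UX [bX [oUX MUX sbX rbX ZX]]] [UY [bY [oUY MUY sbY rbY ZY]]]]] :=
    hint N (fun _ v => v).
  split=> // m Mm; exists setT, (cst 1%:M); split => //; first exact: openT.
    by move=> k; exact: Ck_cst.
  by move=> m' v _ _ _; rewrite mulmx1.
split=> // s t s0 st tT; apply/eqP; rewrite -subr_eq0; apply/eqP.
apply: (additive_dominated_eq0
  (D := fun s t => second X s t - second Y s t) hp hw) s0 st tT.
  move=> a u b a0 au ub bT.
  have [[_ chX _ _ _] _ _] := hX; have [[_ chY _ _ _] _ _] := hY.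
  have u0 := le_trans a0 au; have uT := le_trans ub bT.
  rewrite (chX a u b)// (chY a u b)// /incr.
  have b0 := le_trans u0 ub; have aT := le_trans au uT.
  rewrite !hxy//.
  by rewrite opprD addrACA subrr addr0 opprD addrACA.
move=> c c0 cT.
exact: (second_sub_dominated hp hw hM hX hY hxy
  (And4 oUX MUX sbX rbX) (And4 oUY MUY sbY rbY) ZX ZY c0 cT).
Qed.
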